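(* In the spectrum pooling game $\mathcal G$, the Jacobi-play (JP) dynamic converges to the unique Nash equilibrium if, for every $i$ and $t$, the smoothing parameter $\kappa_i^{(t)}>0$ is set to be less than or equal to $$\bar\kappa_i^{(t)}=\frac{2}{1+(N-1)\,|\bar J_{ij}^{BR}|},$$ where $|\bar J_{ij}^{BR}|$ is a (strict) upper bound on $|J_{ij}^{BR}|$ ($j\neq i$).
   Context: $\mathcal G$ is an $N$-player ($N\ge2$) non-cooperative game: player (operator) $i$ chooses $\beta_i\in S_i=[\beta_i^{min},\beta_i^{max}]$ and has a twice continuously differentiable utility $U_i(\beta_i,\boldsymbol\beta_{-i})$ that is concave in $\beta_i$ (understood as $\partial^2U_i/\partial\beta_i^2<0$) and depends on the opponents' strategies only through their sum $\sum_{j\ne i}\beta_j$. $BR_i(\boldsymbol\beta_{-i})=\arg\max_{\beta_i\in S_i}U_i(\beta_i,\boldsymbol\beta_{-i})$ is the best response. The JP dynamic is the parallel update $$\beta_i^{(t)}=(1-\kappa_i^{(t)})\beta_i^{(t-1)}+\kappa_i^{(t)}BR_i(\boldsymbol\beta_{-i}^{(t-1)}),\quad\forall i,$$ with smoothing parameters $\kappa_i^{(t)}>0$. $J_{ij}^{BR}=\frac{\partial BR_i(\boldsymbol\beta_{-i}^{(t-1)})}{\partial\beta_j}$ ($j\neq i$) is the slope of the best response at the current iterate; for fixed $i$ it is the same for all $j\ne i$. Standing assumption: every operator satisfies $-1<J_{ij}^{BR}<0$ for all $j\ne i$, which is the paper's condition guaranteeing a unique Nash equilibrium. In the paper, convergence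 of an iterative update $\boldsymbol\beta^{(t)}=M(\boldsymbol\beta^{(t-1)})$ is understood by the criterion that the Jacobian $[\partial M_i/\partial\beta_j]$ has all eigenvalues of absolute value less than one. *)

(* Defs.v *)
From mathcomp Require Export all_boot all_order all_algebra.
From mathcomp Require Export all_classical all_reals all_analysis.
From mathcomp Require Export complex.

Set Implicit Arguments.
Unset Strict Implicit.
Unset Printing Implicit Defensive.

Import Order.TTheory GRing.Theory Num.Theory.
Import numFieldNormedType.Exports.

Local Open Scope classical_set_scope.
Local Open Scope ring_scope.

Definition partial (R : realType) (N : nat) (j : 'I_N) (f : 'rV[R]_N -> R)
  (b : 'rV[R]_N) : R := 'D_(delta_mx 0 j) f b.

Definition has_partial (R : realType) (N : nat) (j : 'I_N)
  (f : 'rV[R]_N -> R) (b : 'rV[R]_N) : Prop := derivable f b (delta_mx 0 j).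

(* Only used for open D, so that continuity at the points of D is the
   continuity of the restriction to D. *)
Definition twice_cont_diff_on (R : realType) (N : nat)
    (D : set 'rV[R]_N) (f : 'rV[R]_N -> R) : Prop :=
  forall b, D b ->
  [/\ {for b, continuous f},
      forall j, has_partial j f b /\ {for b, continuous (partial j f)} &
      forall j k, has_partial k (partial j f) b /\
                  {for b, continuous (partial k (partial j f))}].

Definition box (R : realType) (N : nat) (A : 'I_N -> set R) : set 'rV[R]_N :=
  [set b | forall i, A i (b 0 i)].

Definition opp_sum (R : realType) (N : nat) (i : 'I_N) (b : 'rV[R]_N) : R :=
  \sum_(j < N | j != i) b 0 j.

(* The profile (x, b_{-i}). *)
Definition deviate (R : realType) (N : nat) (b : 'rV[R]_N) (i : 'I_N) (x : R) :
    'rV[R]_N :=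
  \row_j (if j == i then x else b 0 j).

(* The utilities are total functions on R^N, but nothing is required of them
   off the product of the open sets [dom i].  The set [dom i] contains player
   i's strategy interval; it is larger because two-sided derivatives are taken
   at the end points of that interval, and because a smoothing parameter above
   1 may push an iterate out of it.  The choice [dom i = setT] is allowed. *)
Record pooling_game (R : realType) (N : nat) := PoolingGame {
  smin : 'I_N -> R;
  smax : 'I_N -> R;
  dom : 'I_N -> set R;
  util : 'I_N -> 'rV[R]_N -> R;
  smin_le_smax : forall i, smin i <= smax i;
  dom_open : forall i, open (dom i);
  dom_strategy : forall i, `[smin i, smax i] `<=` dom i;
  util_C2 : forall i, twice_cont_diff_on (box dom) (util i);
  util_concave : forall i b, box dom b -> partial i (partial i (util i)) b < 0;
  util_aggregative : forall i b c, box dom b -> box dom c ->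
    b 0 i = c 0 i -> opp_sum i b = opp_sum i c -> util i b = util i c
}.

Definition strategy (R : realType) (N : nat) (G : pooling_game R N) (i : 'I_N) :
  set R := `[smin G i, smax G i].

Definition is_best_response (R : realType) (N : nat) (G : pooling_game R N)
    (i : 'I_N) (b : 'rV[R]_N) (x : R) : Prop :=
  strategy G i x /\
  forall y, strategy G i y -> util G i (deviate b i y) <= util G i (deviate b i x).

(* BR_i as a function of the whole profile (constant in the i-th coordinate);
   on [box (dom G)] the maximizer exists and is unique. *)
Definition BR (R : realType) (N : nat) (G : pooling_game R N) (i : 'I_N)
    (b : 'rV[R]_N) : R :=
  get [set x | is_best_response G i b x].

Definition BR_slope (R : realType) (N : nat) (G : pooling_game R N)
    (i j : 'I_N) (b : 'rV[R]_N) : R :=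
  partial j (BR G i) b.

Definition slopes_in_unit (R : realType) (N : nat) (G : pooling_game R N)
    (b : 'rV[R]_N) : Prop :=
  forall i j : 'I_N, j != i ->
    has_partial j (BR G i) b /\ -1 < BR_slope G i j b < 0.

Definition is_NE (R : realType) (N : nat) (G : pooling_game R N)
    (b : 'rV[R]_N) : Prop :=
  box (strategy G) b /\
  forall i x, strategy G i x -> util G i (deviate b i x) <= util G i b.

Definition JP_map (R : realType) (N : nat) (G : pooling_game R N)
    (kappa : 'I_N -> R) (b : 'rV[R]_N) : 'rV[R]_N :=
  \row_i ((1 - kappa i) * b 0 i + kappa i * BR G i b).

Definition jacobian_mx (R : realType) (N : nat) (M : 'rV[R]_N -> 'rV[R]_N)
    (b : 'rV[R]_N) : 'M[R]_N :=
  \matrix_(i, j) partial j (fun c => M c 0 i) b.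

Definition spectrum_in_unit_disc (R : realType) (N : nat) (A : 'M[R]_N) : Prop :=
  forall z : R[i], eigenvalue (map_mx (real_complex R) A) z -> `|z| < 1.

(* Convergence of b(t+1) = M(t+1)(b(t)) to the rest point bstar, in the sense
   of the Jacobian criterion: at every current iterate, all eigenvalues of the
   Jacobian of the update map have modulus less than one.  It is not the
   topological statement that b(t) tends to bstar. *)
Definition converges_by_jacobian (R : realType) (N : nat)
    (M : nat -> 'rV[R]_N -> 'rV[R]_N) (b : nat -> 'rV[R]_N)
    (bstar : 'rV[R]_N) : Prop :=
  [/\ forall t, M t.+1 bstar = bstar,
      forall t i j, has_partial j (fun c => M t.+1 c 0 i) (b t) &
      forall t, spectrum_in_unit_disc (jacobian_mx (M t.+1) (b t))].

(* Main.v *)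
Require Import Defs.
From mathcomp Require Import ring lra.

(* By strict concavity the best response is unique, and by aggregation it is a
   function of the opponents' sum; the slope hypothesis makes it strictly
   decreasing and strictly 1-Lipschitz in that sum.  Hence the strategy that is
   a best reply within a given grand total S is unique, continuous and
   decreasing in S, and the intermediate value theorem in S gives a Nash
   equilibrium; the same monotonicity gives uniqueness.

   For the spectrum, write J_i for the common value of the J_ij.  The Jacobian of
   the update is diag(d) - u 1^T with d_i = 1 - kappa_i (1 + J_i) < 1 and
   u_i = - kappa_i J_i > 0, and kappa_i (1 + (N - 1)|J_i|) < 2 says exactly that
   N u_i < 1 + d_i.  The matrix is similar to a symmetric one; its eigenvalues
   are below 1 because -u 1^T only lowers them, and above -1 because
   \sum_i u_i / (1 + d_i) < 1. *)

Import Order.TTheory GRing.Theory Num.Theory.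
Import numFieldNormedType.Exports.
Local Open Scope classical_set_scope.
Local Open Scope ring_scope.
Set Implicit Arguments.
Unset Strict Implicit.
Unset Printing Implicit Defensive.

(** * Spectrum of a diagonal matrix minus a rank-one matrix *)

Lemma sumr_gt0_ex (R : numDomainType) (I : finType) (F : I -> R) (k : I) :
  (forall i, 0 <= F i) -> 0 < F k -> 0 < \sum_i F i.
Proof.
by move=> F0 Fk; rewrite (bigD1 k)//= ltr_pwDl// sumr_ge0.
Qed.

(* Conjugation by diag(sqrt u) makes the matrix diag(d) - u 1^T symmetric.  This
   is used in the form of the pairing of the eigenvector equation with
   u_j * conj v_j, which gives the reality of z and z < 1; z > -1 comes from
   |c| = |v_j| * (d_j - z), where c = \sum_i v_i u_i. *)
Lemma eigenvalue_diag_sub_col (C : numClosedFieldType) (n : nat)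
    (d u : 'I_n -> C) (v : 'rV[C]_n) (z : C) :
  (forall j, 0 < u j) -> (forall j, d j < 1) ->
  (forall j, n%:R * u j < 1 + d j) -> v != 0 ->
  v *m (\matrix_(i, j) ((d i) *+ (i == j) - u i)) = z *: v -> `|z| < 1.
Proof.
move=> u0 d1 ud /rV0Pn[k vk0] vA.
pose c := \sum_i v 0 i * u i.
have E j : v 0 j * d j - c = z * v 0 j.
  have := congr1 (fun w : 'rV[C]_n => w 0 j) vA; rewrite !mxE => <-.
  rewrite (bigD1 j)//= !mxE eqxx mulr1n /c [in LHS](bigD1 j)//= mulrBr opprD addrA.
  congr (_ + _); rewrite -sumrN; apply: eq_bigr => i /negPf ij.
  by rewrite !mxE ij sub0r mulrN.
have uR j : u j \is Num.real by rewrite gtr0_real.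
have dR j : d j \is Num.real by rewrite (ler_real (ltW (d1 j))).
pose q := \sum_j u j * `|v 0 j| ^+ 2.
have q0 : 0 < q.
  apply: (@sumr_gt0_ex _ _ _ k) => [j|].
    by rewrite mulr_ge0// ?exprn_ge0// ltW.
  by rewrite mulr_gt0// exprn_gt0// normr_gt0.
have zq : z * q = \sum_j u j * d j * `|v 0 j| ^+ 2 - `|c| ^+ 2.
  have -> : `|c| ^+ 2 = \sum_j u j * (v 0 j)^* * c.
    rewrite normCK -mulr_suml mulrC; congr (_ * _).
    rewrite /c rmorph_sum; apply: eq_bigr => j _.
    by rewrite rmorphM /= (CrealP (uR j)) mulrC.
  rewrite -sumrB mulr_sumr; apply: eq_bigr => j _.
  rewrite normCK.
  have -> : z * (u j * (v 0 j * (v 0 j)^*)) = u j * (v 0 j)^* * (z * v 0 j) by ring.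
  by rewrite -E; ring.
have zR : z \is Num.real.
  rewrite -[z](mulfK (lt0r_neq0 q0)) rpredM ?rpredV ?(gtr0_real q0)// zq.
  rewrite rpredB ?rpredX ?normr_real// rpred_sum// => j _.
  by rewrite !rpredM// normr_real.
rewrite real_ltr_norml//; apply/andP; split; last first.
  (* Here [(1 - z) * q] equals [\sum_j u j * (1 - d j) * |v_j|^2 + |c|^2]. *)
  rewrite -subr_gt0 -(pmulr_lgt0 _ q0) mulrBl mul1r zq opprB addrCA addrC.
  rewrite -sumrB ltr_pwDl ?exprn_ge0//.
  apply: (@sumr_gt0_ex _ _ _ k) => [j|]; rewrite -mulrBl -{1}[u _]mulr1 -mulrBr.
    by rewrite !mulr_ge0 ?exprn_ge0 ?subr_ge0// ltW.
  by rewrite !mulr_gt0 ?exprn_gt0 ?normr_gt0 ?subr_gt0.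
rewrite real_ltNge ?rpredN1//; apply/negP => z1.
have dz j : n%:R * u j < d j - z.
  by apply: (lt_le_trans (ud j)); rewrite addrC lerD2l lerNr.
have nc j : `|c| = `|v 0 j| * (d j - z).
  have -> : c = v 0 j * (d j - z) by rewrite mulrBr -[v 0 j * z]mulrC -E; ring.
  rewrite normrM [`|d j - z|]ger0_norm// ltW// (le_lt_trans _ (dz j))//.
  by rewrite mulr_ge0 ?ler0n// ltW.
(* If [z <= -1], then [n * u j < d j - z], so [|c|] is at least [n * |v_j| * u j], strictly where
   [v_j] is nonzero. Averaging over [j] contradicts the triangle inequality for [c]. *)
have : 0 < \sum_j (`|c| - n%:R * (`|v 0 j| * u j)).
  apply: (@sumr_gt0_ex _ _ _ k) => [j|].
    by rewrite subr_ge0 (nc j) mulrCA ler_wpM2l// ltW.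
  by rewrite subr_gt0 (nc k) mulrCA ltr_pM2l ?normr_gt0.
rewrite sumrB -mulr_sumr sumr_const card_ord -[`|c| *+ n]mulr_natl -mulrBr.
rewrite pmulr_rgt0 ?ltr0n ?(leq_ltn_trans _ (ltn_ord k))// subr_gt0.
move=> /lt_geF/negbT/negP; apply.
apply: le_trans (ler_norm_sum _ _ _) _.
by apply: ler_sum => j _; rewrite normrM [`|u j|]gtr0_norm.
Qed.

(** * Derivatives along lines; maximizers of strictly concave functions *)

Lemma is_derive_along (R : numFieldType) (U V W : normedModType R)
    (f : U -> W) (g : V -> W) (a u : U) (b v : V) (l : W) :
  (\forall h \near (0 : R), f (h *: u + a) = g (h *: v + b)) ->
  is_derive b v g l -> is_derive a u f l.
Proof.
move=> fg.
have fg0 : f a = g b by have := nbhs_singleton fg; rewrite !scale0r !add0r.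
have Q : \forall h \near 0^', h^-1 *: ((g \o shift b) (h *: v) - g b) = 
   h^-1 *: ((f \o shift a) (h *: u) - f a).
  by apply: nbhs_dnbhs; near=> h; rewrite /= fg0 (near fg h).
move=> [dg dgl]; split.
  apply/cvg_ex; exists l; rewrite -dgl.
  by apply: cvg_trans dg; exact: near_eq_cvg.
apply/cvg_lim => //; rewrite -dgl.
by apply: cvg_trans dg; exact: near_eq_cvg.
Unshelve. all: by end_near.
Qed.

Lemma box_near (R : realType) (N : nat) (A : 'I_N -> set R) (a u : 'rV[R]_N) :
  (forall i, open (A i)) -> box A a -> \forall h \near (0 : R), box A (h *: u + a).
Proof.
move=> oA Aa.
suff H i : \forall h \near (0 : R), A i ((h *: u + a) 0 i).
  exact: (@filter_forall _ _ _ (nbhs (0 : R)) _ H).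
have : (h * u 0 i + a 0 i) @[h --> (0 : R)] --> a 0 i.
  rewrite -[X in _ --> X]add0r -[X in _ --> X + _](mul0r (u 0 i)).
  by apply: cvgD; [apply: cvgM; [exact: cvg_id|exact: cvg_cst]|exact: cvg_cst].
move=> /(_ (A i)) H.
have /H : nbhs (a 0 i) (A i) by apply: open_nbhs_nbhs; split => //; exact: Aa.
move=> P; have {}P : \forall h \near (0 : R), A i (h * u 0 i + a 0 i) by exact: P.
by near=> h; rewrite !mxE; near: h.
Unshelve. all: by end_near.
Qed.

(** Two maximizers [x < y] have equal values, so Rolle gives a critical point [c] between them. As
    [f'] strictly decreases, it is positive just where the mean value theorem evaluates it on
    [[x, c]], whence [f x < f c], a contradiction. *)
Lemma uniq_max_of_concave (R : realType) (f f' f'' : R -> R) (a b : R) :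
  (forall x, x \in `[a, b] -> is_derive x 1 f (f' x)) ->
  (forall x, x \in `[a, b] -> is_derive x 1 f' (f'' x)) ->
  (forall x, x \in `[a, b] -> f'' x < 0) ->
  {in `[a, b] &, forall x y, (forall z, z \in `[a, b] -> f z <= f x) ->
     (forall z, z \in `[a, b] -> f z <= f y) -> x = y}.
Proof.
move=> df df' f''0.
suff H : {in `[a, b] &, forall x y, (forall z, z \in `[a, b] -> f z <= f x) ->
     (forall z, z \in `[a, b] -> f z <= f y) -> ~ x < y}.
  move=> x y xi yi mx my; apply/eqP; rewrite eq_le !leNgt; apply/andP; split.
    by apply/negP; exact: H.
  by apply/negP; exact: H.
move=> x y; rewrite !in_itv/= => /andP[ax xb] /andP[ay yb] mx my xy.
have sub z : x <= z <= y -> z \in `[a, b].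
  by move=> /andP[xz zy]; rewrite in_itv/=; apply/andP; split; lra.
have fxy : f x = f y.
  by apply/eqP; rewrite eq_le mx ?my//; apply: sub; rewrite lexx ltW.
have cont (g g' : R -> R) s t : x <= s -> t <= y ->
    (forall x, x \in `[a, b] -> is_derive x 1 g (g' x)) ->
    {within `[s, t], continuous g}.
  move=> xs ty dg; apply: derivable_within_continuous => z.
  rewrite in_itv/= => /andP[sz zt].
  by have [] := dg z; first by apply: sub; lra.
have [||c] := @Rolle R f x y xy _ _ fxy.
- move=> z; rewrite in_itv/= => /andP[sz zt].
  by have [] := df z; first by apply: sub; lra.
- exact: cont df.
rewrite in_itv/= => /andP[xc cy] dc.
have f'c : f' c = 0.
  have ci : c \in `[a, b] by apply: sub; lra.
  by have [_ <-] := df c ci; case: dc.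
have mvt (g g' : R -> R) s t : x <= s -> s < t -> t <= y ->
    (forall x, x \in `[a, b] -> is_derive x 1 g (g' x)) ->
    exists2 e, s < e < t & g t - g s = g' e * (t - s).
  move=> xs st ty dg.
  have dg' z : z \in `]s, t[ -> is_derive z 1 g (g' z).
    by rewrite in_itv/= => /andP[sz zt]; apply: dg; apply: sub; lra.
  have [e ei ?] := MVT st dg' (cont _ _ _ _ xs ty dg).
  by exists e => //; rewrite in_itv/= in ei.
have [e /andP[xe ec] fe] := mvt f f' x c (lexx x) xc (ltW cy) df.
have [e2 /andP[xe2 ec2] fe2] := mvt f' f'' e c (ltW xe) ec (ltW cy) df'.
have f''e : f'' e2 < 0 by apply: f''0; apply: sub; lra.
have fc : f c <= f x by apply: mx; apply: sub; lra.
have f'e : 0 < f' e.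
  have : f'' e2 * (c - e) < 0 by rewrite nmulr_rlt0 ?subr_gt0.
  lra.
have : 0 < f' e * (c - x) by rewrite mulr_gt0 ?subr_gt0.
lra.
Qed.

Lemma is_derive_along_all (R : numFieldType) (U V W : normedModType R)
    (f : U -> W) (g : V -> W) (a u : U) (b v : V) (l : W) :
  (forall h : R, f (h *: u + a) = g (h *: v + b)) ->
  is_derive b v g l -> is_derive a u f l.
Proof.
move=> fg; apply: is_derive_along; near=> h; exact: fg.
Unshelve. all: by end_near.
Qed.

(** * Unilateral deviations and opponents' sums *)

Lemma deviateD (R : realType) (N : nat) (b : 'rV[R]_N) (i : 'I_N) (h x : R) :
  deviate b i (h + x) = h *: delta_mx 0 i + deviate b i x.
Proof.
apply/rowP => j; rewrite !mxE eqxx /=.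
by case: eqP => _; rewrite /= ?mulr1 ?mulr0 ?add0r.
Qed.

Lemma deviate_id (R : realType) (N : nat) (b : 'rV[R]_N) (i : 'I_N) :
  deviate b i (b 0 i) = b.
Proof. by apply/rowP => j; rewrite mxE; case: eqP => [->|]. Qed.

Lemma opp_sum_deviate (R : realType) (N : nat) (b : 'rV[R]_N) (i : 'I_N) (x : R) :
  opp_sum i (deviate b i x) = opp_sum i b.
Proof. by apply: eq_bigr => j /negPf ji; rewrite mxE ji. Qed.

Lemma opp_sumE (R : realType) (N : nat) (b : 'rV[R]_N) (i : 'I_N) :
  opp_sum i b = \sum_j b 0 j - b 0 i.
Proof. by rewrite [X in _ = X - _](bigD1 i)//= addrAC subrr add0r. Qed.

Lemma opp_sumD (R : realType) (N : nat) (i : 'I_N) (h : R) (u a : 'rV[R]_N) :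
  opp_sum i (h *: u + a) = h * opp_sum i u + opp_sum i a.
Proof.
by rewrite mulr_sumr -big_split/=; apply: eq_bigr => j _; rewrite !mxE.
Qed.

Lemma opp_sum_delta (R : realType) (N : nat) (i j : 'I_N) : j != i ->
  opp_sum i (delta_mx 0 j) = 1 :> R.
Proof.
move=> ji; rewrite /opp_sum (bigD1 j)//= mxE !eqxx big1 ?addr0// => k.
by case/andP => _ /negPf kj; rewrite mxE kj.
Qed.

Lemma box_strategy_dom (R : realType) (N : nat) (G : pooling_game R N)
  (b : 'rV[R]_N) : box (strategy G) b -> box (dom G) b.
Proof. by move=> bS i; apply: dom_strategy; exact: bS. Qed.

Lemma box_deviate (R : realType) (N : nat) (A : 'I_N -> set R)
    (b : 'rV[R]_N) (i : 'I_N) (x : R) :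
  box A b -> A i x -> box A (deviate b i x).
Proof. by move=> bA xA j; rewrite mxE; case: eqP => [->|]. Qed.

Lemma is_derive_deviate (R : realType) (N : nat) (f : 'rV[R]_N -> R)
    (b : 'rV[R]_N) (i : 'I_N) (x : R) :
  has_partial i f (deviate b i x) ->
  is_derive x 1 (fun y => f (deviate b i y)) (partial i f (deviate b i x)).
Proof.
move=> df; have := DeriveDef df erefl; apply: is_derive_along_all.
by move=> h; rewrite -deviateD [_ *: _]mulr1.
Qed.

(** * Best responses: existence, uniqueness, dependence on the opponents' sum *)

Lemma best_response_unique (R : realType) (N : nat) (G : pooling_game R N)
    (i : 'I_N) (b : 'rV[R]_N) (x y : R) : box (dom G) b ->
  is_best_response G i b x -> is_best_response G i b y -> x = y.
Proof.
move=> bD [xS mx] [yS my].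
have dev z : strategy G i z -> box (dom G) (deviate b i z).
  by move=> zS; apply: box_deviate => //; exact: dom_strategy.
pose U := util G i.
apply: (@uniq_max_of_concave R (fun z => U (deviate b i z))
  (fun z => partial i U (deviate b i z))
  (fun z => partial i (partial i U) (deviate b i z)) (smin G i) (smax G i)) => //.
- move=> z zS; apply: is_derive_deviate.
  by have [_ /(_ i)[]] := util_C2 i (dev _ zS).
- move=> z zS; apply: is_derive_deviate.
  by have [_ _ /(_ i i)[]] := util_C2 i (dev _ zS).
- by move=> z zS; apply: util_concave; exact: dev.
Qed.

Lemma BRP (R : realType) (N : nat) (G : pooling_game R N) (i : 'I_N)
  (b : 'rV[R]_N) : box (dom G) b -> is_best_response G i b (BR G i b).
Proof.
move=> bD.
have cont : {within `[smin G i, smax G i],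
    continuous (fun z => util G i (deviate b i z))}.
  apply: derivable_within_continuous => z zS.
  have : has_partial i (util G i) (deviate b i z).
    have dz : box (dom G) (deviate b i z).
      by apply: box_deviate => //; exact: dom_strategy.
    by have [_ /(_ i)[]] := util_C2 i dz.
  by move=> /is_derive_deviate[].
have [x xS mx] := EVT_max (smin_le_smax G i) cont.
apply: (@getPex _ [set x | is_best_response G i b x]).
by exists x; split.
Qed.

Lemma BR_strategy (R : realType) (N : nat) (G : pooling_game R N) (i : 'I_N)
  (b : 'rV[R]_N) : box (dom G) b -> smin G i <= BR G i b <= smax G i.
Proof. by move=> /(BRP i)[]; rewrite /strategy/= in_itv. Qed.

Lemma is_NE_BR (R : realType) (N : nat) (G : pooling_game R N) (b : 'rV[R]_N) :
  is_NE G b <-> box (strategy G) b /\ forall i, BR G i b = b 0 i.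
Proof.
split=> [[bS mb]|[bS bBR]]; split=> // i.
  have bD := box_strategy_dom bS.
  apply: (best_response_unique bD (BRP i bD)); split => [|y yS]; first exact: bS.
  by rewrite deviate_id; exact: mb.
move=> x xS; have [_ /(_ _ xS)] := BRP i (box_strategy_dom bS).
by rewrite bBR deviate_id.
Qed.

Lemma BR_aggregative (R : realType) (N : nat) (G : pooling_game R N) (i : 'I_N)
    (b c : 'rV[R]_N) : box (dom G) b -> box (dom G) c ->
  opp_sum i b = opp_sum i c -> BR G i b = BR G i c.
Proof.
move=> bD cD bc; apply: (best_response_unique bD (BRP i bD)).
have U z : strategy G i z -> util G i (deviate b i z) = util G i (deviate c i z).
  move=> zS; apply: util_aggregative; rewrite ?opp_sum_deviate//.
  - by apply: box_deviate => //; exact: dom_strategy.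
  - by apply: box_deviate => //; exact: dom_strategy.
  - by rewrite !mxE eqxx.
have [xS mx] := BRP i cD; split=> // y yS.
by rewrite !U//; exact: mx.
Qed.

(** * Slopes and monotonicity of best responses *)

(** Near [b], which is interior to the open box, [BR G i] depends only on the opponents' sum, so all
    directions that raise this sum at unit speed give the same derivative. *)
Lemma BR_is_derive (R : realType) (N : nat) (G : pooling_game R N) (i j : 'I_N)
    (b u : 'rV[R]_N) : box (dom G) b -> has_partial j (BR G i) b -> j != i ->
  opp_sum i u = 1 -> is_derive b u (BR G i) (BR_slope G i j b).
Proof.
move=> bD dj ji u1.
have := DeriveDef dj erefl; apply: is_derive_along.
have oD := @dom_open _ _ G.
near=> h; apply: BR_aggregative.
- by near: h; exact: box_near.
- by near: h; exact: box_near.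
- by rewrite !opp_sumD u1 opp_sum_delta.
Unshelve. all: by end_near.
Qed.

(** The set of best replies does not change with player [i]'s own coordinate, and [get] depends only
    on that set; hence no domain hypothesis. *)
Lemma BR_own (R : realType) (N : nat) (G : pooling_game R N) (i : 'I_N)
  (b : 'rV[R]_N) : is_derive b (delta_mx 0 i) (BR G i) 0.
Proof.
have := is_derive_cst (BR G i b) b (delta_mx 0 i).
apply: is_derive_along_all => h.
have D x : deviate (h *: delta_mx 0 i + b) i x = deviate b i x.
  apply/rowP => k; rewrite !mxE eqxx /=; case: eqP => // _.
  by rewrite mulr0 add0r.
rewrite /BR; congr (get _); apply/seteqP; rewrite /is_best_response.
by split=> x /= [xS mx]; split=> // y yS; have := mx y yS; rewrite !D.
Qed.

(** Mean value theorem on the segment from [b] to [c], which stays in the convex strategy box, where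
    the slopes lie in [(-1, 0)]. *)
Lemma BR_decreasing (R : realType) (N : nat) (G : pooling_game R N)
    (i j : 'I_N) (b c : 'rV[R]_N) :
  (forall c, box (strategy G) c -> slopes_in_unit G c) -> j != i ->
  box (strategy G) b -> box (strategy G) c -> opp_sum i b < opp_sum i c ->
  0 < BR G i b - BR G i c < opp_sum i c - opp_sum i b.
Proof.
move=> slopes ji bS cS; rewrite -subr_gt0 => lt_bc.
set l := opp_sum i c - opp_sum i b in lt_bc *.
(* Normalized so that player i's opponents' sum moves at unit speed: the
   derivative of BR_i along u is then the slope itself. *)
pose u := l^-1 *: (c - b).
have u1 : opp_sum i u = 1.
  have -> : u = l^-1 *: c + (- l^-1) *: b by rewrite /u scalerBr scaleNr.
  rewrite opp_sumD -[(- l^-1) *: b]addr0 opp_sumD.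
  have -> : opp_sum i (0 : 'rV[R]_N) = 0 by apply: big1 => k _; rewrite mxE.
  by rewrite addr0 mulNr -mulrBr mulVf// gt_eqF.
have seg x : x \in `[0, l] -> box (strategy G) (x *: u + b).
  rewrite in_itv/= => /andP[x0 xl] k; rewrite /strategy !mxE/= in_itv/=.
  have := bS k; have := cS k.
  rewrite /strategy/= !in_itv/= => /andP[c1 c2] /andP[b1 b2].
  set y := x / l; have y0 : 0 <= y by rewrite divr_ge0// ltW.
  have y1 : y <= 1 by rewrite ler_pdivrMr// mul1r.
  rewrite mulrA -/y; apply/andP; split; nra.
have d x : x \in `[0, l] ->
    is_derive x 1 (fun x => BR G i (x *: u + b)) (BR_slope G i j (x *: u + b)).
  move=> xl; have xS := seg _ xl.
  have [dj _] := slopes _ xS i j ji.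
  have := BR_is_derive (box_strategy_dom xS) dj ji u1.
  apply: is_derive_along_all => h.
  by rewrite [_ *: 1]mulr1 scalerDl addrA.
have dl x : x \in `]0, l[ ->
    is_derive x 1 (fun x => BR G i (x *: u + b)) (BR_slope G i j (x *: u + b)).
  by move=> /subset_itv_oo_cc; exact: d.
have cont : {within `[0, l], continuous (fun x => BR G i (x *: u + b))}.
  by apply: derivable_within_continuous => x /d[].
have [x xi] := MVT lt_bc dl cont.
rewrite scale0r add0r subr0 scalerA divff ?gt_eqF// scale1r subrK => E.
have [_ /andP[s1 s2]] := slopes _ (seg _ (subset_itv_oo_cc xi)) i j ji.
by rewrite -opprB E -mulNr pmulr_lgt0// oppr_gt0 s2/= gtr_pMl// ltrNl.
Qed.

(** * Existence of a Nash equilibrium *)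

Lemma continuous_of_slope (R : realType) (phi : R -> R) :
  (forall s t, s < t -> 0 <= phi s - phi t < t - s) -> continuous phi.
Proof.
move=> H s; apply/cvgrPdist_le => e e0; near=> t.
have : `|s - t| <= e.
  by near: t; exact: (@cvgr_dist_le _ _ _ (nbhs s) _ id s (@cvg_id _ _) e e0).
apply: le_trans.
have [st|ts|->] := ltgtP s t; last by rewrite !subrr.
- have /andP[h1 h2] := H _ _ st.
  by rewrite ger0_norm// distrC [`|t - s|]gtr0_norm ?subr_gt0// ltW.
- have /andP[h1 h2] := H _ _ ts.
  by rewrite distrC ger0_norm// [`|s - t|]gtr0_norm ?subr_gt0// ltW.
Unshelve. all: by end_near.
Qed.

Lemma aggregate_fixpoint (R : realType) (N : nat) (phi : 'I_N -> R -> R)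
    (lo hi : 'I_N -> R) :
  (forall i s, lo i <= phi i s <= hi i) ->
  (forall i s t, s < t -> 0 <= phi i s - phi i t < t - s) ->
  exists x : 'rV[R]_N, forall i, x 0 i = phi i (opp_sum i x).
Proof.
move=> bnd slope.
have g_lt i s t : s < t -> s + phi i s < t + phi i t.
  by move=> st; have /andP[_] := slope i _ _ st; lra.
have g_inj i s t : s + phi i s = t + phi i t -> s = t.
  move=> E; have [st|ts|//] := ltgtP s t.
    by have := g_lt i _ _ st; rewrite E ltxx.
  by have := g_lt i _ _ ts; rewrite E ltxx.
(* [sg i S] is what the opponents must play in total for the grand total to be
   S when i replies by [phi i]; a fixed point is a total S with
   [\sum_i (S - sg i S) = S]. *)
have /choice[sg sgE] : forall i,
    exists sg : R -> R, forall S, sg S + phi i (sg S) = S.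
  move=> i; suff /choice[sg] : forall S, exists s, s + phi i s = S by exists sg.
  move=> S.
  (* Since [phi i] takes values in [[lo i, hi i]], [s + phi i s] is at most [S] at the left end and
     at least [S] at the right end. *)
  have lohi : S - hi i <= S - lo i by have /andP[] := bnd i 0; lra.
  have cont : {within `[S - hi i, S - lo i], continuous (fun s => s + phi i s)}.
    apply: continuous_subspaceT => s; apply: cvgD; first exact: cvg_id.
    exact: continuous_of_slope (slope i) _.
  have [|s _ sS] := @IVT R _ _ _ S lohi cont; last by exists s.
  rewrite ge_min le_max.
  have /andP[h1 h2] := bnd i (S - hi i); have /andP[h3 h4] := bnd i (S - lo i).
  by apply/andP; split; apply/orP; [left|right]; lra.
have sg_lt i S T : S < T -> sg i S < sg i T.
  move=> ST; rewrite ltNge; apply/negP; rewrite le_eqVlt => /predU1P[E|/(g_lt i)].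
    by move: ST; rewrite -(sgE i S) -(sgE i T) E ltxx.
  by rewrite !sgE; lra.
have sgK i s : sg i (s + phi i s) = s by apply: (g_inj i); rewrite sgE.
(* A strictly increasing map that is onto the interval between its end values is continuous;
   preimages are explicit by [sgK]. *)
have sg_cont i A B : {within `[A, B], continuous (sg i)}.
  apply: segment_inc_surj_continuous.
    by move=> S T _ _; exact: (le_mono (sg_lt i)).
  move=> s; rewrite /= in_itv/= => /andP[As sB]; exists (s + phi i s) => //=.
  rewrite in_itv/=; apply/andP; split; rewrite leNgt; apply/negP.
    by move/(sg_lt i); rewrite sgK; lra.
  by move/(sg_lt i); rewrite sgK; lra.
pose A := \sum_i lo i; pose B := \sum_i hi i.
pose T S := \sum_i (S - sg i S) - S.
have AB : A <= B.
  by apply: ler_sum => i _; have /andP[] := bnd i 0; exact: le_trans.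
have T_cont : {within `[A, B], continuous T}.
  have idc : {within `[A, B], continuous (@id R)}.
    by apply: continuous_subspaceT => s; exact: cvg_id.
  move=> S; apply: cvgB; last exact: idc.
  apply: (@continuous_big R _ _ _ _ add_continuous (subspace `[A, B]) _
    (fun i (S : subspace `[A, B]) => (S : R) - sg i S)) => i _ x.
  by apply: cvgB; [exact: idc|exact: sg_cont].
have phiE i S : S - sg i S = phi i (sg i S).
  by rewrite -{1}(sgE i S) addrAC subrr add0r.
(* Each [S - sg i S] is a value of [phi i], so the sum lies between [A] and [B], giving
   [T B <= 0 <= T A]. *)
have [|S _ TS] := @IVT R T A B 0 AB T_cont.
  rewrite ge_min le_max; apply/andP; split; apply/orP; [right|left].
    rewrite subr_le0; apply: ler_sum => i _.
    by rewrite phiE; have /andP[] := bnd i (sg i B).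
  rewrite subr_ge0; apply: ler_sum => i _.
  by rewrite phiE; have /andP[] := bnd i (sg i A).
exists (\row_i (S - sg i S)) => i.
rewrite opp_sumE !mxE; under eq_bigr do rewrite mxE.
by move/eqP: TS; rewrite subr_eq0 => /eqP ->; rewrite subKr phiE.
Qed.

Lemma exists_neq_ord (N : nat) (i : 'I_N) : (2 <= N)%N -> exists j : 'I_N, j != i.
Proof.
move=> hN; have [i0|i0] := eqVneq (val i) 0%N.
  by exists (Ordinal hN); rewrite -val_eqE i0.
by exists (Ordinal (ltnW hN)); rewrite -val_eqE eq_sym.
Qed.

(** Slopes are controlled only on strategy profiles, whereas [aggregate_fixpoint] wants functions on
    the whole line. Clamping the opponents' total is monotone and 1-Lipschitz, so it keeps the slope
    bounds, and at the fixed point, a strategy profile, it is inactive. *)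
Lemma exists_NE (R : realType) (N : nat) (G : pooling_game R N) : (2 <= N)%N ->
  (forall c, box (strategy G) c -> slopes_in_unit G c) -> exists b, is_NE G b.
Proof.
move=> hN slopes.
pose lo : 'rV[R]_N := \row_i smin G i; pose hi : 'rV[R]_N := \row_i smax G i.
pose L i := opp_sum i lo; pose H i := opp_sum i hi.
have LH i : L i <= H i by apply: ler_sum => j _; rewrite !mxE smin_le_smax.
pose cl i s := Num.max (L i) (Num.min (H i) s).
have cl_itv i s : L i <= cl i s <= H i.
  by rewrite /cl le_max lexx ge_max LH ge_min lexx.
have cl_id i s : L i <= s <= H i -> cl i s = s.
  by case/andP=> Ls sH; rewrite /cl min_r// max_r.
have cl_slope i s t : s < t -> 0 <= cl i t - cl i s <= t - s.
  have := LH i; rewrite /cl; move: (L i) (H i) => l h lh st.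
  by case: (leP h s); case: (leP h t) => ? ?; case: (leP l s); case: (leP l t);
    case: (leP l h) => ? ? ?; apply/andP; split; lra.
(* A strategy profile in which player i's opponents play s in total, s being
   clamped to the feasible totals (if these reduce to one point, the quotient
   is 0/0 = 0). *)
pose p i s := (cl i s - L i) / (H i - L i) *: (hi - lo) + lo.
have p_box i s : box (strategy G) (p i s).
  move=> j; rewrite /strategy/= in_itv/= !mxE.
  set y := _ / _; have /andP[h1 h2] := cl_itv i s.
  have y0 : 0 <= y by rewrite divr_ge0// subr_ge0.
  have y1 : y <= 1.
    have := LH i; rewrite le_eqVlt => /predU1P[E|lt].
      by rewrite /y E subrr invr0 mulr0 ler01.
    by rewrite ler_pdivrMr ?subr_gt0// mul1r lerD2r.
  by have := smin_le_smax G j => hj; apply/andP; split; nra.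
have p_opp i s : opp_sum i (p i s) = cl i s.
  rewrite opp_sumD.
  have -> : opp_sum i (hi - lo) = H i - L i.
    by rewrite addrC -scaleN1r opp_sumD mulN1r addrC.
  have := LH i; rewrite le_eqVlt => /predU1P[E|lt].
    have := cl_itv i s; rewrite -E -eq_le => /eqP <-.
    by rewrite subrr !mul0r add0r.
  by rewrite divfK ?subrK// gt_eqF// subr_gt0.
have pD i s := box_strategy_dom (p_box i s).
have [|i s t st|x xE] := @aggregate_fixpoint R N (fun i s => BR G i (p i s))
    (smin G) (smax G).
- by move=> i s; exact: BR_strategy.
- have [j ji] := exists_neq_ord i hN; have := cl_slope i _ _ st.
  (* Where the clamp is flat the best reply is constant; this is why [aggregate_fixpoint] asks only
     for weak monotonicity. *)
  rewrite subr_ge0 le_eqVlt => /andP[/predU1P[E _|lt le]].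
    rewrite (@BR_aggregative R N G i (p i s) (p i t))// ?p_opp//.
    by rewrite subrr lexx subr_gt0.
  have := @BR_decreasing R N G i j (p i s) (p i t) slopes ji (p_box i s) (p_box i t).
  rewrite !p_opp => /(_ lt) /andP[h1 h2].
  by rewrite ltW//=; exact: lt_le_trans le.
have xS : box (strategy G) x.
  by move=> i; rewrite /strategy/= in_itv/= xE BR_strategy.
exists x; apply/is_NE_BR; split=> // i.
rewrite [RHS]xE; apply: BR_aggregative => //; first exact: box_strategy_dom.
rewrite p_opp cl_id//; apply/andP; split; apply: ler_sum => j _; rewrite mxE.
  by have := xS j; rewrite /strategy/= in_itv/= => /andP[].
by have := xS j; rewrite /strategy/= in_itv/= => /andP[].
Qed.

(** * Uniqueness of the Nash equilibrium *)

Lemma NE_unique (R : realType) (N : nat) (G : pooling_game R N) (b c : 'rV[R]_N) :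
  (2 <= N)%N -> (forall c, box (strategy G) c -> slopes_in_unit G c) ->
  is_NE G b -> is_NE G c -> b = c.
Proof.
move=> hN slopes.
(* Suppose [x_i < y_i]. A smaller opponents' sum in [x] would make [x_i] the larger reply; a larger
   one exceeds that of [y] by more than [y_i - x_i], so the total of [x] would exceed that of
   [y]. *)
have le_coord (x y : 'rV[R]_N) i : is_NE G x -> is_NE G y ->
    \sum_j x 0 j <= \sum_j y 0 j -> y 0 i <= x 0 i.
  move=> /is_NE_BR[xS xE] /is_NE_BR[yS yE] xy; rewrite leNgt; apply/negP.
  have [j ji] := exists_neq_ord i hN.
  rewrite -xE -yE => lt.
  have [xy_lt|yx_lt|xy_eq] := ltgtP (opp_sum i x) (opp_sum i y).
  - by have /andP[] := BR_decreasing slopes ji xS yS xy_lt; lra.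
  - have /andP[_] := BR_decreasing slopes ji yS xS yx_lt.
    by rewrite !opp_sumE -xE -yE; lra.
  - move: lt; rewrite (BR_aggregative (box_strategy_dom xS)
      (box_strategy_dom yS) xy_eq).
    by rewrite ltxx.
suff le_eq x y : is_NE G x -> is_NE G y -> \sum_j x 0 j <= \sum_j y 0 j -> x = y.
  move=> nb nc; have [bc|/ltW cb] := leP (\sum_j b 0 j) (\sum_j c 0 j).
    exact: le_eq.
  by apply/esym/le_eq.
move=> nx ny xy; apply/rowP => i; apply/eqP.
rewrite eq_le [X in _ && X]le_coord// andbT.
(* The coordinatewise bounds reverse the inequality of totals, so [le_coord] applies again with [x]
   and [y] exchanged. *)
by apply: (le_coord _ _ _ ny nx); apply: ler_sum => j _; exact: le_coord.
Qed.

(** * The Jacobian of the JP update and its spectrum *)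

Lemma BR_slope_opponent (R : realType) (N : nat) (G : pooling_game R N)
    (i j k : 'I_N) (b : 'rV[R]_N) :
  box (dom G) b -> has_partial j (BR G i) b -> j != i -> k != i ->
  BR_slope G i k b = BR_slope G i j b.
Proof.
move=> bD dj ji ki.
by have [_] := BR_is_derive bD dj ji (opp_sum_delta R ki).
Qed.

Lemma JP_map_is_derive (R : realType) (N : nat) (G : pooling_game R N)
    (kappa : 'I_N -> R) (i : 'I_N) (b u : 'rV[R]_N) (l : R) :
  is_derive b u (BR G i) l ->
  is_derive b u (fun c => JP_map G kappa c 0 i)
    ((1 - kappa i) * u 0 i + kappa i * l).
Proof.
move=> dBR.
have dcoord : is_derive b u (fun c : 'rV[R]_N => c 0 i) (u 0 i).
  have := is_derive_id (b 0 i) (u 0 i).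
  by apply: is_derive_along_all => h; rewrite !mxE.
have := is_deriveD (is_deriveZ (1 - kappa i) dcoord) (is_deriveZ (kappa i) dBR).
by apply: is_derive_along_all => h; rewrite mxE.
Qed.

Lemma JP_spectrum (R : realType) (N : nat) (kappa J : 'I_N -> R) (A : 'M[R]_N) :
  (forall i, A i i = 1 - kappa i) ->
  (forall i j, j != i -> A i j = kappa i * J i) ->
  (forall i, -1 < J i < 0) -> (forall i, 0 < kappa i) ->
  (forall i, kappa i * (1 + (N%:R - 1) * `|J i|) < 2) ->
  spectrum_in_unit_disc A.
Proof.
move=> Aii Aij J1 k0 k2 z /eigenvalueP[v vA v0].
pose d i := 1 - kappa i * (1 + J i); pose u i := - (kappa i * J i).
apply: (@eigenvalue_diag_sub_col _ N
  (fun i => (d i)%:C%C) (fun i => (u i)%:C%C) v) => //.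
- move=> i; have /andP[_ h] := J1 i.
  by rewrite (ltcR 0) oppr_gt0 nmulr_llt0.
- move=> i; have /andP[h _] := J1 i.
  have ? : 0 < kappa i * (1 + J i) by rewrite mulr_gt0//; lra.
  by rewrite (ltcR _ 1) /d; lra.
- move=> i; rewrite -(rmorph_nat (real_complex R)).
  rewrite -[X in _ < X + _](rmorph1 (real_complex R)).
  rewrite -rmorphM -rmorphD ltcR /u /d.
  have /andP[_ h] := J1 i; have := k2 i; rewrite ltr0_norm//.
  by lra.
rewrite -vA; congr (_ *m _); apply/matrixP => i j; rewrite !mxE.
have [->|ij] := eqVneq i j.
  by rewrite Aii mulr1n -rmorphB; congr (_%:C%C); rewrite /d /u; ring.
by rewrite Aij 1?eq_sym// mulr0n sub0r -rmorphN opprK.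
Qed.

Theorem proposition11 (R : realType) (N : nat) (hN : (2 <= N)%N)
  (G : pooling_game R N)
  (kappa : nat -> 'I_N -> R) (b : nat -> 'rV[R]_N) (Jbar : nat -> 'I_N -> R)
  (slopes_strategies : forall c, box (strategy G) c -> slopes_in_unit G c)
  (JP : forall t, b t.+1 = JP_map G (kappa t.+1) (b t))
  (iterates_dom : forall t, box (dom G) (b t))
  (slopes_iterates : forall t, slopes_in_unit G (b t))
  (Jbar_bound : forall t (i j : 'I_N), j != i ->
     `|BR_slope G i j (b t)| < `|Jbar t.+1 i|)
  (kappa_gt0 : forall t i, 0 < kappa t.+1 i)
  (kappa_le : forall t i,
     kappa t.+1 i <= 2 / (1 + (N%:R - 1) * `|Jbar t.+1 i|)) :
  exists bstar : 'rV[R]_N,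
    [/\ is_NE G bstar,
        forall c, is_NE G c -> c = bstar &
        converges_by_jacobian (fun t => JP_map G (kappa t)) b bstar].
Proof.
have [bs bsNE] := exists_NE hN slopes_strategies.
exists bs; split=> // [c cNE|]; first exact: NE_unique cNE bsNE.
split=> [t|t i j|t].
- have /is_NE_BR[_ bsE] := bsNE.
  by apply/rowP => i; rewrite mxE bsE -mulrDl subrK mul1r.
- have [->|ji] := eqVneq j i; first by
    have [] := JP_map_is_derive (kappa t.+1) (BR_own G i (b t)).
  have [dj _] := slopes_iterates t i j ji.
  by have [] := JP_map_is_derive (kappa t.+1) (DeriveDef dj erefl).
have opponent i := exists_neq_ord i hN.
(* [2 <= N] provides an opponent; which one is chosen is immaterial by [BR_slope_opponent]. *)
pose J i := BR_slope G i (xchoose (opponent i)) (b t).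
have Ji i j : j != i -> BR_slope G i j (b t) = J i.
  move=> ji; have oi := xchooseP (opponent i).
  by have [dj _] := slopes_iterates t i _ oi; exact: BR_slope_opponent.
apply: (@JP_spectrum _ _ (kappa t.+1) J) => // [i|i j ji|i|i].
- rewrite mxE; have [_] := JP_map_is_derive (kappa t.+1) (BR_own G i (b t)).
  by rewrite /partial => ->; rewrite mxE !eqxx mulr1 mulr0 addr0.
- rewrite mxE; have [dj _] := slopes_iterates t i j ji.
  have [_] := JP_map_is_derive (kappa t.+1) (DeriveDef dj erefl).
  rewrite /partial => ->; rewrite mxE eqxx eq_sym (negPf ji) mulr0 add0r.
  by rewrite -(Ji i j ji).
- by have [] := slopes_iterates t i _ (xchooseP (opponent i)).
(* The bound on [kappa] is weak; strictness comes from [|J i| < |Jbar t.+1 i|], multiplied by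
   [N - 1 > 0]. *)
- have := kappa_le t i; have := Jbar_bound t i _ (xchooseP (opponent i)).
  rewrite -/(J i) => lt; have N1 : 1 <= N%:R - 1 :> R.
    by rewrite lerBrDr -[1 + 1]/(2%:R) ler_nat.
  have Jb0 : 0 <= `|Jbar t.+1 i| by [].
  rewrite ler_pdivlMr; last by nra.
  apply: lt_le_trans; rewrite ltr_pM2l// ltrD2l ltr_pM2l//; lra.
Qed.
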